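(* Let $A\in M_n(\mathbb{Z})$ be invertible such that $x\mapsto A^{-1}x$ is a similarity with respect to Euclidean distance. Let $\mathcal{D}$ be a complete residue system mod $A$ such that $T_{A,\mathcal{D}}$ is a self-affine tile, and let $D\subset\mathcal{D}$ be such that every element of $T_{A,D-D}$ has a unique $(A,D-D)$-representation. Then for every $\lambda\in[0,\dim_H T_{A,D}]$, the level set $\Psi_{A,D}^{-1}(\lambda)$ is dense in $F_{A,D}$.
   Context: A similarity means a map $f$ with $\|f(x)-f(y)\|=c\|x-y\|$ for some $c\in(0,1)$ and all $x,y$. For finite $E\subset\mathbb{R}^n$, $\pi_{A,E}((e_j)_{j\ge1})=\sum_{j\ge1}A^{-j}e_j$, $T_{A,E}=\pi_{A,E}(E^{\mathbb{N}})$, and an $(A,E)$-representation of $x$ is a sequence $(e_j)\in E^{\mathbb{N}}$ with $\pi_{A,E}((e_j))=x$. $D-D=\{a-b:a,b\in D\}$. A complete residue system mod $A$ is a set $\mathcal{D}\subset\mathbb{Z}^n$ mapping bijectively onto $\mathbb{Z}^n/A\mathbb{Z}^n$. $T_{A,\mathcal{D}}$ is a self-affine tile if it is the closure of its interior and $\lambda_n((T_{A,\mathcal{D}}+d)\cap(T_{A,\mathcal{D}}+d'))=0$ for all distinct $d,d'\in\mathcal{D}$ ($\lambda_n$ = Lebesgue measure). $F_{A,D}=\{\alpha\in\mathbb{R}^n: T_{A,D}\cap(T_{A,D}+\alpha)\ne\emptyset\}$, and $\Psi_{A,D}:F_{A,D}\to[0,\dim_H T_{A,D}]$ is $\Psi_{A,D}(\alpha)=\dim_H(T_{A,D}\cap(T_{A,D}+\alpha))$.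 *)

(* Defs.v *)
From HB Require Import structures.
From mathcomp Require Import all_boot all_order all_algebra.
From mathcomp Require Import all_classical all_reals all_analysis.
Set Implicit Arguments. Unset Strict Implicit. Unset Printing Implicit Defensive.
Import Order.TTheory GRing.Theory Num.Theory.
Import numFieldNormedType.Exports.
Local Open Scope classical_set_scope.
Local Open Scope ring_scope.

Section Defs.
Variables (R : realType) (n : nat).

(* R^n is modelled by column vectors 'cV[R]_n (product topology = Euclidean). *)
Definition enorm (x : 'cV[R]_n) : R := Num.sqrt (\sum_(i < n) x i 0 ^+ 2).

Definition realv (d : 'cV[int]_n) : 'cV[R]_n := map_mx (fun z : int => z%:~R) d.
Definition realm (A : 'M[int]_n) : 'M[R]_n := map_mx (fun z : int => z%:~R) A.

Definition is_similarity (f : 'cV[R]_n -> 'cV[R]_n) : Prop :=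
  exists c : R, 0 < c < 1 /\
    forall x y, enorm (f x - f y) = c * enorm (x - y).

(* (A,E)-representation: (e_j)_{j>=1} (indexed here by j.+1) with
   sum_{j>=1} A^{-j} e_j = x, the series converging in R^n. *)
Definition is_rep (A : 'M[int]_n) (E : set 'cV[R]_n)
  (e : nat -> 'cV[R]_n) (x : 'cV[R]_n) : Prop :=
  (forall j, E (e j)) /\
  (fun N => \sum_(j < N) (invmx (realm A) ^+ j.+1) *m e j) @ \oo --> x.

Definition T_set (A : 'M[int]_n) (E : set 'cV[R]_n) : set 'cV[R]_n :=
  [set x | exists e, is_rep A E e x].

Definition unique_reps (A : 'M[int]_n) (E : set 'cV[R]_n) : Prop :=
  forall x, T_set A E x -> forall e e', is_rep A E e x -> is_rep A E e' x -> e = e'.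

Definition real_digits (D : set 'cV[int]_n) : set 'cV[R]_n := realv @` D.

Definition diff_set (E : set 'cV[R]_n) : set 'cV[R]_n :=
  [set a - b | a in E & b in E].

Definition translate (S : set 'cV[R]_n) (a : 'cV[R]_n) : set 'cV[R]_n :=
  [set x + a | x in S].

Definition in_lattice (A : 'M[int]_n) (z : 'cV[int]_n) : Prop :=
  exists w : 'cV[int]_n, z = A *m w.

Definition complete_residue_system (A : 'M[int]_n) (D : set 'cV[int]_n) : Prop :=
  (forall d d', D d -> D d' -> in_lattice A (d - d') -> d = d') /\
  (forall z : 'cV[int]_n, exists2 d, D d & in_lattice A (z - d)).

Definition box (a b : 'cV[R]_n) : set 'cV[R]_n :=
  [set x | forall i, a i 0 <= x i 0 <= b i 0].

Definition box_vol (a b : 'cV[R]_n) : R := \prod_(i < n) (b i 0 - a i 0).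

Definition lebesgue_null (S : set 'cV[R]_n) : Prop :=
  forall eps : R, 0 < eps -> exists (a b : nat -> 'cV[R]_n),
    (forall k i, a k i 0 <= b k i 0) /\
    S `<=` \bigcup_k box (a k) (b k) /\
    (forall N, \sum_(k < N) box_vol (a k) (b k) <= eps).

Definition self_affine_tile (A : 'M[int]_n) (D : set 'cV[int]_n) : Prop :=
  let T := T_set A (real_digits D) in
  closure (interior T) = T /\
  forall d d', D d -> D d' -> d != d' ->
    lebesgue_null (translate T (realv d) `&` translate T (realv d')).

Definition diam (U : set 'cV[R]_n) : R :=
  sup [set enorm (x - y) | x in U & y in U].

Definition hausdorff_content (s delta : R) (S : set 'cV[R]_n) : \bar R :=
  ereal_inf [set (\sum_(k <oo) ((diam (U k)) `^ s)%:E)%E |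
     U in [set U : nat -> set 'cV[R]_n |
            S `<=` \bigcup_k U k /\
            forall k x y, U k x -> U k y -> enorm (x - y) <= delta]].

Definition hausdorff_measure (s : R) (S : set 'cV[R]_n) : \bar R :=
  ereal_sup [set hausdorff_content s delta S | delta in [set d : R | 0 < d]].

Definition hausdorff_dim (S : set 'cV[R]_n) : R :=
  inf [set s : R | 0 < s /\ hausdorff_measure s S = 0%E].

Definition F_set (A : 'M[int]_n) (D : set 'cV[int]_n) : set 'cV[R]_n :=
  let T := T_set A (real_digits D) in
  [set alpha | T `&` translate T alpha !=set0].

Definition Psi (A : 'M[int]_n) (D : set 'cV[int]_n) (alpha : 'cV[R]_n) : R :=
  let T := T_set A (real_digits D) in
  hausdorff_dim (T `&` translate T alpha).

End Defs.

Arguments real_digits R {n} D.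
Arguments realm R {n} A.
Arguments realv R {n} d.
Arguments self_affine_tile R {n} A D.

(* Main.v *)
Require Import Defs.
From HB Require Import structures.
From mathcomp Require Import all_boot all_order all_algebra.
From mathcomp Require Import all_classical all_reals all_analysis.
From mathcomp Require Import ring lra zify.
Set Implicit Arguments. Unset Strict Implicit. Unset Printing Implicit Defensive.
Import Order.TTheory GRing.Theory Num.Theory.
Import numFieldNormedType.Exports.
Local Open Scope classical_set_scope.
Local Open Scope ring_scope.

(** By uniqueness of the [D - D]-representations, if [alpha] has digits [a_j]
    then [T] meets [T + alpha] exactly in the points all of whose digits [d_j]
    lie in [D] and in [D + a_j].  To approximate [alpha], keep its first [m]
    digits and then use only the digit [0], which leaves all [q = #|D|] choices
    for [d_j], and a longest difference [a* = d1 - d0], which leaves only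
    [d_j = d1].  If the digit [0] is used with frequency [t], where
    [q^t = c^(-lambda)], along the jumps of [k |-> floor (k t)], the dimension
    is [lambda].

    Upper bounds on the dimension come from counting cylinders.  For the lower
    bound, the free digits are read off the base-[q] expansion of a real number
    in [[0, 1[]: truncated sums are [A^-k] times integer points which, [D] being
    part of a residue system, determine their digits, so that a set of diameter
    at most [c^k] meets boundedly many cylinders of level [k], and a cover of
    small [s]-content would pull back to a cover of [[0, 1[] of Lebesgue measure
    less than [1]. *)

(** * The Euclidean norm *)

Lemma enorm_ge0 (R : realType) n (x : 'cV[R]_n) : 0 <= enorm x.
Proof. exact: sqrtr_ge0. Qed.

Lemma sqr_enorm (R : realType) n (x : 'cV[R]_n) :
  enorm x ^+ 2 = \sum_(i < n) x i 0 ^+ 2.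
Proof. by rewrite sqr_sqrtr // sumr_ge0 // => i _; exact: sqr_ge0. Qed.

Lemma enorm0 (R : realType) n : enorm (0 : 'cV[R]_n) = 0.
Proof.
by rewrite /enorm big1 ?sqrtr0 // => i _; rewrite mxE expr0n.
Qed.

Lemma enormN (R : realType) n (x : 'cV[R]_n) : enorm (- x) = enorm x.
Proof. by rewrite /enorm; under eq_bigr do rewrite mxE sqrrN. Qed.

Lemma enorm_coord (R : realType) n (x : 'cV[R]_n) i : `|x i 0| <= enorm x.
Proof.
rewrite -(@ler_pXn2r _ 2) ?nnegrE ?enorm_ge0// sqr_enorm real_normK ?num_real//.
by rewrite (bigD1 i)//= lerDl sumr_ge0 // => j _; exact: sqr_ge0.
Qed.

(** The quadratic [\sum_i (t * x i - y i) ^+ 2] in [t] is nonnegative; its value at the minimiser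
    [s / a] gives the inequality, and [a = 0] forces [x = 0]. *)
Lemma sum_cauchy_schwarz (R : realType) n (x y : 'I_n -> R) :
  (\sum_i x i * y i) ^+ 2 <= (\sum_i x i ^+ 2) * (\sum_i y i ^+ 2).
Proof.
set a := \sum_i x i ^+ 2; set b := \sum_i y i ^+ 2; set s := \sum_i x i * y i.
have a0 : 0 <= a by apply: sumr_ge0 => i _; exact: sqr_ge0.
have H t : 0 <= a * t ^+ 2 - 2 * s * t + b.
  have -> : a * t ^+ 2 - 2 * s * t + b = \sum_i (t * x i - y i) ^+ 2.
    rewrite /a /b /s mulr_suml -mulrA mulr_suml mulr_sumr -sumrB -big_split /=.
    by apply: eq_bigr => i _; ring.
  by apply: sumr_ge0 => i _; exact: sqr_ge0.
have [a00|a_neq0] := eqVneq a 0.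
  have x0 i : x i = 0.
    apply/eqP; rewrite -sqrf_eq0; apply/eqP.
    have /psumr_eq0P : \sum_i x i ^+ 2 = 0 by [].
    by apply => // j _; exact: sqr_ge0.
  by rewrite /s big1 ?expr0n ?a00 ?mul0r // => i _; rewrite x0 mul0r.
have ap : 0 < a by rewrite lt_neqAle eq_sym a_neq0.
have := H (s / a).
have -> : a * (s / a) ^+ 2 - 2 * s * (s / a) + b = (a * b - s ^+ 2) / a by field.
by rewrite pmulr_lge0 ?invr_gt0 ?subr_ge0.
Qed.

Lemma enormD (R : realType) n (x y : 'cV[R]_n) :
  enorm (x + y) <= enorm x + enorm y.
Proof.
rewrite -(@ler_pXn2r _ 2) ?nnegrE ?enorm_ge0 ?addr_ge0 ?enorm_ge0//.
rewrite sqrrD !sqr_enorm.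
have -> : \sum_(i < n) (x + y) i 0 ^+ 2 = \sum_(i < n) x i 0 ^+ 2 +
    (\sum_(i < n) x i 0 * y i 0) *+ 2 + \sum_(i < n) y i 0 ^+ 2.
  rewrite -mulr_natl mulr_sumr -!big_split /=; apply: eq_bigr => i _.
  by rewrite mxE; ring.
rewrite lerD2r lerD2l lerMn2r orFb.
rewrite (le_trans (ler_norm _)) //.
rewrite -(@ler_pXn2r _ 2) ?nnegrE ?mulr_ge0 ?enorm_ge0// exprMn !sqr_enorm.
by rewrite real_normK ?num_real//; exact: sum_cauchy_schwarz.
Qed.

Lemma enormB (R : realType) n (x y z : 'cV[R]_n) :
  enorm (x - z) <= enorm (x - y) + enorm (y - z).
Proof. by rewrite (le_trans _ (enormD _ _)) // addrA subrK. Qed.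

Lemma norm_le_enorm (R : realType) n (x : 'cV[R]_n) : `|x| <= enorm x.
Proof.
rewrite [leLHS]/Num.norm /= mx_normrE.
apply/bigmax_leP; split => [|[i j] _ /=]; first exact: enorm_ge0.
by rewrite ord1 enorm_coord.
Qed.

(** Convergence in ['cV[R]_n] is governed by the sup norm; the crude factor [n] avoids a square
    root. *)
Lemma enorm_le_norm (R : realType) n (x : 'cV[R]_n) : enorm x <= n%:R * `|x|.
Proof.
rewrite -(@ler_pXn2r _ 2) ?nnegrE ?enorm_ge0 ?mulr_ge0// sqr_enorm.
apply: (@le_trans _ _ (\sum_(i < n) `|x| ^+ 2)).
  apply: ler_sum => i _; rewrite -(real_normK (num_real (x i 0))).
  rewrite ler_pXn2r ?nnegrE// [leRHS]/Num.norm /= mx_normrE.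
  by apply/bigmax_geP; right; exists (i, 0).
rewrite sumr_const card_ord -[leLHS]mulr_natl exprMn ler_wpM2r ?sqr_ge0//.
by rewrite -natrX ler_nat; case: n {x} => // n; rewrite leq_pmulr.
Qed.

(** * Digit series of a contracting similarity *)

Definition psum (R : realType) n (B : 'M[R]_n) (e : nat -> 'cV[R]_n) (N : nat) :=
  \sum_(j < N) (B ^+ j.+1) *m e j.

Section ContractingSeries.
Variables (R : realType) (n : nat) (B : 'M[R]_n) (c : R).
Hypothesis c01 : 0 < c < 1.
Hypothesis Bc : forall x : 'cV[R]_n, enorm (B *m x) = c * enorm x.

Lemma enorm_expmx k (x : 'cV[R]_n) : enorm (B ^+ k *m x) = c ^+ k * enorm x.
Proof.
elim: k => [|k IH]; first by rewrite !expr0 mul1r mul1mx.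
by rewrite !exprS -mulmxA Bc IH mulrA.
Qed.

Lemma psumS (e : nat -> 'cV[R]_n) N :
  psum B e N.+1 = psum B e N + B ^+ N.+1 *m e N.
Proof. by rewrite /psum big_ord_recr. Qed.

Lemma psum_tail (e : nat -> 'cV[R]_n) (K : R) k N :
  (forall j, enorm (e j) <= K) -> (k <= N)%N ->
  enorm (psum B e N - psum B e k) <= K / (1 - c) * c ^+ k.
Proof.
have /andP[c0 c1] := c01.
move=> eK kN; have K0 : 0 <= K := le_trans (enorm_ge0 _) (eK 0).
have K1 : 0 <= K / (1 - c) by rewrite divr_ge0// subr_ge0 ltW.
(* The geometric tail is kept as [c ^+ k - c ^+ N], a form that induction on [N] can carry. *)
suff : enorm (psum B e N - psum B e k) <= K / (1 - c) * (c ^+ k - c ^+ N).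
  move=> /le_trans; apply; rewrite ler_wpM2l// gerBl exprn_ge0//.
  exact: ltW.
elim: N kN => [|N IH].
  by rewrite leqn0 => /eqP ->; rewrite !subrr enorm0 mulr0.
rewrite leq_eqVlt => /orP[/eqP <-|]; first by rewrite !subrr enorm0 mulr0.
rewrite ltnS => /IH {}IH.
rewrite psumS addrAC (le_trans (enormD _ _))//.
have -> : K / (1 - c) * (c ^+ k - c ^+ N.+1) =
    K / (1 - c) * (c ^+ k - c ^+ N) + K * c ^+ N.
  by rewrite exprS; field; rewrite subr_eq0 gt_eqF.
rewrite lerD// enorm_expmx mulrC ler_pM ?enorm_ge0 ?exprn_ge0 ?(ltW c0)//.
by rewrite ler_wiXn2l ?(ltW c0) ?(ltW c1).
Qed.

Lemma psum_lim_dist (e : nat -> 'cV[R]_n) (K : R) (x : 'cV[R]_n) k :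
  (forall j, enorm (e j) <= K) -> psum B e @ \oo --> x ->
  enorm (x - psum B e k) <= K / (1 - c) * c ^+ k.
Proof.
move=> eK /cvgrPdist_le ex; apply/ler_addgt0Pr => eps eps0.
(* The denominator pays for passing from the sup norm to [enorm] and is nonzero even for [n = 0]. *)
have d0 : 0 < eps / n.+1%:R by rewrite divr_gt0.
have [N _ HN] := ex _ d0.
pose M := maxn N k.
rewrite (le_trans (enormB _ (psum B e M) _))// addrC lerD//.
  by rewrite psum_tail ?leq_maxr.
rewrite (le_trans (enorm_le_norm _))//.
have /= := HN M (leq_maxl _ _).
rewrite ler_pdivlMr// mulrC; apply: le_trans.
by rewrite ler_wpM2r// ler_nat.
Qed.

Lemma expr_mul_lt_eps (K eps : R) : 0 < eps ->
  exists N, forall k, (N <= k)%N -> K * c ^+ k < eps.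
Proof.
have /andP[c0 c1] := c01; move=> eps0.
have c1' : `|c| < 1 by rewrite gtr0_norm.
have K1 : 0 < `|K| + 1 by rewrite ltr_wpDl.
have : \forall k \near \oo, `|0 - c ^+ k| < eps / (`|K| + 1).
  by move: (cvg_expr c1') => /cvgrPdist_lt; apply; rewrite divr_gt0.
case=> N _ HN; exists N => k Nk; have := HN k Nk => /=.
rewrite sub0r normrN gtr0_norm ?exprn_gt0// ltr_pdivlMr//.
apply: le_lt_trans; rewrite mulrC ler_wpM2l ?exprn_ge0 ?(ltW c0)//.
by rewrite (le_trans (ler_norm _))// lerDl.
Qed.

Lemma psum_is_cvg (e : nat -> 'cV[R]_n) (K : R) :
  (forall j, enorm (e j) <= K) -> cvg (psum B e @ \oo).
Proof.
move=> eK; apply: cauchy_cvg; apply: cauchy_exP => eps eps0.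
have [k /(_ k (leqnn _)) Hk] := expr_mul_lt_eps (K / (1 - c)) eps0.
exists (psum B e k); exists k => // N /= kN.
rewrite -ball_normE /= -normrN opprB.
rewrite (le_lt_trans (norm_le_enorm _))// (le_lt_trans _ Hk)//.
exact: psum_tail.
Qed.

End ContractingSeries.

(** * Hausdorff measure and dimension *)

Section HausdorffDimension.
Variables (R : realType) (n : nat).
Implicit Types (S U : set 'cV[R]_n) (s d r : R).

Lemma diam_le U r : 0 <= r ->
  (forall x y, U x -> U y -> enorm (x - y) <= r) -> diam U <= r.
Proof.
move=> r0 Ur; rewrite /diam; set E := [set _ | _ in _ & _ in _].
have [->|/set0P E0] := eqVneq E set0; first by rewrite sup0.
by apply: ge_sup => // _ [x Ux [y Uy <-]]; exact: Ur.
Qed.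

(** An unbounded set has the default [sup] [0], whence the bound asked on the distances in [U]. *)
Lemma le_diam U r x y : (forall x y, U x -> U y -> enorm (x - y) <= r) ->
  U x -> U y -> enorm (x - y) <= diam U.
Proof.
move=> Ur Ux Uy; apply: ub_le_sup; last by exists x => //; exists y.
by exists r => _ [x' Ux' [y' Uy' <-]]; exact: Ur.
Qed.

Lemma diam_set0 : diam (set0 : set 'cV[R]_n) = 0.
Proof.
rewrite /diam (_ : [set _ | _ in _ & _ in _] = set0) ?sup0//.
by apply/seteqP; split => // ? [].
Qed.

Lemma diam_ge0 U r : (forall x y, U x -> U y -> enorm (x - y) <= r) ->
  0 <= diam U.
Proof.
have [->|/set0P[x Ux]] := eqVneq U set0; first by rewrite diam_set0.
by move=> Ur; apply: le_trans (le_diam Ur Ux Ux); exact: enorm_ge0.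
Qed.

Lemma hausdorff_content_ge0 s d S : (0 <= hausdorff_content s d S)%E.
Proof.
apply: le_ereal_inf_tmp => _ [U _ <-].
by apply: nneseries_ge0 => k _ _; rewrite lee_fin powR_ge0.
Qed.

Lemma hausdorff_measure_eq0_cover s d eps S :
  hausdorff_measure s S = 0%E -> 0 < d -> 0 < eps ->
  exists U : nat -> set 'cV[R]_n, [/\ S `<=` \bigcup_k U k,
    forall k x y, U k x -> U k y -> enorm (x - y) <= d &
    (\sum_(k <oo) ((diam (U k)) `^ s)%:E < eps%:E)%E].
Proof.
move=> H0 d0 eps0.
have : (hausdorff_content s d S < eps%:E)%E.
  apply: (@le_lt_trans _ _ 0%E); last by rewrite lte_fin.
  by rewrite -H0; apply: le_ereal_sup_tmp; exists (hausdorff_content s d S) => //; exists d.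
by move=> /ereal_inf_lt[_ [U [SU Ud] <-] Ueps]; exists U.
Qed.

(** Finite covers by sets of a common diameter bound suffice: they are completed by empty sets, of
    diameter [0], which contribute nothing because [s > 0]. *)
Lemma hausdorff_measure_eq0 s S : 0 < s ->
  (forall d eps, 0 < d -> 0 < eps ->
    exists (N : nat) (r : R) (V : nat -> set 'cV[R]_n),
    [/\ 0 <= r <= d, N%:R * r `^ s <= eps,
      forall x, S x -> exists2 i, (i < N)%N & V i x &
      forall i x y, V i x -> V i y -> enorm (x - y) <= r]) ->
  hausdorff_measure s S = 0%E.
Proof.
move=> s0 H; apply/eqP; rewrite eq_le; apply/andP; split; last first.
  apply: le_ereal_sup_tmp; exists (hausdorff_content s 1 S).
    by exists 1 => //=; exact: ltr01.
  exact: hausdorff_content_ge0.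
apply: ge_ereal_sup => _ [d /= d0 <-].
apply/lee_addgt0Pr => eps eps0; rewrite add0e.
have [N [r [V [/andP[r0 rd] Neps SV Vr]]]] := H _ _ d0 eps0.
pose U k := if (k < N)%N then V k else set0.
apply: ge_ereal_inf; eexists.
  exists U; last by [].
  split; last first.
    move=> k x y; rewrite /U; case: ifP => // _ Vx Vy.
    by apply: le_trans rd; exact: Vr Vx Vy.
  by move=> x /SV[i iN Vi]; exists i => //; rewrite /U iN.
have U0 k : (0 <= ((diam (U k)) `^ s)%:E :> \bar R)%E by rewrite lee_fin powR_ge0.
rewrite (@nneseries_split R _ 0 N) ?add0n//.
rewrite [X in (_ + X)%E](_ : _ = 0%E); last first.
  apply: (@eseries0 _ _ _ xpredT) => k Nk _.
  rewrite /U ltnNge Nk /= diam_set0 powR0 ?gt_eqF//.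
rewrite adde0; apply: (@le_trans _ _ (\sum_(0 <= k < N) (r `^ s)%:E)%E).
  rewrite !big_nat; apply: lee_sum => k /andP[_ kN]; rewrite lee_fin.
  have Ur x y : U k x -> U k y -> enorm (x - y) <= r by rewrite /U kN; exact: Vr.
  by rewrite ge0_ler_powR ?nnegrE ?(ltW s0) ?(diam_ge0 Ur) ?diam_le.
rewrite sumEFin lee_fin big_const_nat subn0 iter_addr_0 -mulr_natl.
exact: Neps.
Qed.

Lemma hausdorff_dim_le S (l : R) : 0 <= l ->
  (forall s, l < s -> hausdorff_measure s S = 0%E) -> hausdorff_dim S <= l.
Proof.
move=> l0 H; apply/ler_addgt0Pr => eps eps0; apply: ge_inf.
  by exists 0 => s [/ltW].
by split; [rewrite ltr_wpDl|apply: H; rewrite ltrDl].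
Qed.

(** The bound [l'] ensures that the infimum is over a nonempty set; an empty one would have the
    default infimum [0]. *)
Lemma le_hausdorff_dim S (l l' : R) : 0 <= l' ->
  (forall s, l' < s -> hausdorff_measure s S = 0%E) ->
  (forall s, 0 < s -> s < l -> hausdorff_measure s S <> 0%E) ->
  l <= hausdorff_dim S.
Proof.
move=> l0 Hf H; apply: lb_le_inf.
  by exists (l' + 1); split; [rewrite ltr_wpDl|apply: Hf; rewrite ltrDl].
by move=> s [s0 Hs]; rewrite leNgt; apply/negP => /(H _ s0); exact.
Qed.

End HausdorffDimension.

(** * Upper bounds on the dimension by counting cylinders *)

Section UpperBound.
Variables (R : realType) (n : nat) (B : 'M[R]_n) (c : R).
Hypothesis c01 : 0 < c < 1.
Hypothesis Bc : forall x : 'cV[R]_n, enorm (B *m x) = c * enorm x.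
Variable J : nat -> seq 'cV[R]_n.

(** [J j] lists the digits allowed at rank [j]. Each word of length [k] gives one centre, and the
    points whose digits begin with this word lie within a constant times [c ^+ k] of it. *)
Fixpoint cylinder_centers k : seq 'cV[R]_n :=
  if k is k'.+1 then
    [seq z + B ^+ k'.+1 *m d | z <- cylinder_centers k', d <- J k']
  else [:: 0].

Lemma size_cylinder_centers k :
  size (cylinder_centers k) = (\prod_(j < k) size (J j))%N.
Proof.
elim: k => [|k IH]; first by rewrite big_ord0.
by rewrite big_ord_recr /= size_allpairs IH.
Qed.

Lemma psum_cylinder_centers (e : nat -> 'cV[R]_n) k :
  (forall j, e j \in J j) -> psum B e k \in cylinder_centers k.
Proof.
move=> eJ; elim: k => [|k IH]; first by rewrite /psum big_ord0 inE.
by rewrite psumS /=; apply: allpairs_f.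
Qed.

(** At level [k], at most [C * c^(-l k)] balls of radius of order [c^k] cover [S], so the
    [s]-content is of order [c^((s - l) k)], which tends to [0]. *)
Lemma hausdorff_measure_digits_eq0 (K C l s : R) (S : set 'cV[R]_n) :
  (forall j d, d \in J j -> enorm d <= K) -> 0 <= K -> 0 <= l < s ->
  (forall k, (\prod_(j < k) size (J j))%N%:R <= C * (c `^ (- l)) ^+ k) ->
  (forall x, S x -> exists2 e, forall j, e j \in J j & psum B e @ \oo --> x) ->
  hausdorff_measure s S = 0%E.
Proof.
have /andP[c0 c1] := c01; move=> JK K0 /andP[l0 ls] JC SJ.
have s0 : 0 < s := le_lt_trans l0 ls.
apply: hausdorff_measure_eq0 => // d eps d0 eps0.
pose K' := K / (1 - c).
have K'0 : 0 <= K' by rewrite divr_ge0// subr_ge0 ltW.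
have sl01 : 0 < c `^ (s - l) < 1.
  rewrite powR_gt0//=; have := @gt0_ltr_powR R (s - l).
  rewrite subr_gt0 => /(_ ls c 1).
  by rewrite !nnegrE powR1 ler01 (ltW c0) => /(_ isT isT c1).
have [N1 HN1] := expr_mul_lt_eps c01 (K' + K') d0.
have [N2 HN2] := expr_mul_lt_eps sl01 (C * (K' + K') `^ s) eps0.
pose k := maxn N1 N2.
pose r := (K' + K') * c ^+ k.
have r0 : 0 <= r by rewrite mulr_ge0 ?addr_ge0 ?exprn_ge0 ?(ltW c0).
exists (\prod_(j < k) size (J j))%N, r.
exists (fun i => [set x | enorm (x - nth 0 (cylinder_centers k) i) <= K' * c ^+ k]).
split.
- by rewrite r0 ltW//; apply: HN1; exact: leq_maxl.
- apply: le_trans (ltW (HN2 k (leq_maxr _ _))).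
  rewrite powRM ?addr_ge0 ?exprn_ge0 ?(ltW c0)//.
  have -> : c `^ (s - l) = c `^ (- l) * c `^ s.
    by rewrite -powRD ?(gt_eqF c0) ?implybT// addrC.
  have -> : (c ^+ k) `^ s = (c `^ s) ^+ k.
    by rewrite -!powR_mulrn ?powR_ge0 ?(ltW c0)// -!powRrM mulrC.
  rewrite exprMn mulrCA [leRHS]mulrAC mulrA.
  rewrite [X in _ <= X](_ : _ = (K' + K') `^ s * (C * (c `^ (- l)) ^+ k * (c `^ s) ^+ k)); last by ring.
  by rewrite -mulrA ler_wpM2l ?powR_ge0// ler_wpM2r ?exprn_ge0 ?powR_ge0.
- move=> x /SJ[e eJ ex].
  have := psum_cylinder_centers k eJ.
  rewrite -index_mem size_cylinder_centers => ik.
  exists (index (psum B e k) (cylinder_centers k)) => //=.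
  rewrite nth_index ?psum_cylinder_centers//.
  by apply: psum_lim_dist => // j; exact: JK (eJ j).
- move=> i x y /= xi yi; rewrite /r mulrDl.
  rewrite (le_trans (enormB _ (nth 0 (cylinder_centers k) i) _))// lerD//.
  by rewrite -enormN opprB.
Qed.

End UpperBound.

(** * Lower bounds on the dimension by pulling covers back to [[0, 1[] *)

Section LowerBound.
Variables (R : realType) (n : nat) (A : 'M[int]_n) (B : 'M[R]_n) (c : R).
Hypothesis c01 : 0 < c < 1.
Hypothesis Bc : forall x : 'cV[R]_n, enorm (B *m x) = c * enorm x.
Hypothesis BA : B *m realm R A = 1%:M.

Lemma realvD (x y : 'cV[int]_n) : realv R (x + y) = realv R x + realv R y.
Proof. exact: map_mxD. Qed.

Lemma realvB (x y : 'cV[int]_n) : realv R (x - y) = realv R x - realv R y.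
Proof. exact: map_mxB. Qed.

Lemma realv_inj : injective (@realv R n).
Proof.
move=> x y /matrixP xy; apply/matrixP => i j.
by have := xy i j; rewrite !mxE => /intr_inj.
Qed.

Lemma realvM (z : 'cV[int]_n) : B *m realv R (A *m z) = realv R z.
Proof.
by rewrite /realv map_mxM mulmxA -/(realm R A) BA mul1mx.
Qed.

(** The Horner form of [A^k] times the truncated sum stays in the integers, where residues mod [A]
    can be read. *)
Fixpoint lattice_point (e : nat -> 'cV[int]_n) k : 'cV[int]_n :=
  if k is k'.+1 then A *m lattice_point e k' + e k' else 0.

Lemma psum_lattice_point e k :
  psum B (fun j => realv R (e j)) k = B ^+ k *m realv R (lattice_point e k).
Proof.
elim: k => [|k IH]; first by rewrite /psum big_ord0 /realv map_mx0 mulmx0.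
rewrite psumS IH /= realvD mulmxDr; congr (_ + _).
by rewrite exprSr -mulmxA realvM.
Qed.

(** The last digit is determined by the residue of the lattice point mod [A]; once it is removed,
    [A] cancels and the earlier digits follow by induction. *)
Lemma lattice_point_inj (D : set 'cV[int]_n) e e' k :
  (forall d d', D d -> D d' -> in_lattice A (d - d') -> d = d') ->
  (forall j, D (e j)) -> (forall j, D (e' j)) ->
  lattice_point e k = lattice_point e' k ->
  forall j, (j < k)%N -> e j = e' j.
Proof.
move=> Dres De De'; elim: k => // k IH /= zz.
have ek : e k = e' k.
  apply: Dres => //; exists (lattice_point e' k - lattice_point e k).
  rewrite mulmxBr; apply/eqP; rewrite subr_eq addrAC eq_sym subr_eq eq_sym.
  by rewrite [e k + _]addrC zz addrC.
have {}zz : lattice_point e k = lattice_point e' k.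
  apply: realv_inj; rewrite -[LHS]realvM -[RHS]realvM.
  by move: zz; rewrite ek => /addIr ->.
by move=> j; rewrite ltnS leq_eqVlt => /orP[/eqP ->|/(IH zz)].
Qed.

(** Each truncated sum is within a constant times [c ^+ k] of its limit, and [A^k] expands distances
    by [c^(-k)]; the bound is therefore uniform in [k]. *)
Lemma lattice_point_dist (e e' : nat -> 'cV[int]_n) (x x' : 'cV[R]_n) (K : R) k :
  (forall j, enorm (realv R (e j)) <= K) ->
  (forall j, enorm (realv R (e' j)) <= K) ->
  psum B (fun j => realv R (e j)) @ \oo --> x ->
  psum B (fun j => realv R (e' j)) @ \oo --> x' ->
  enorm (x - x') <= c ^+ k ->
  enorm (realv R (lattice_point e k) - realv R (lattice_point e' k)) <=
    1 + (K / (1 - c) + K / (1 - c)).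
Proof.
have /andP[c0 c1] := c01; move=> eK eK' ex ex' xx'.
rewrite -(@ler_pM2l _ (c ^+ k)) ?exprn_gt0// -(enorm_expmx Bc) mulmxBr.
rewrite -!psum_lattice_point.
set K' := K / (1 - c).
have -> : c ^+ k * (1 + (K' + K')) = K' * c ^+ k + (c ^+ k + K' * c ^+ k) by ring.
rewrite (le_trans (enormB _ x _))// lerD//.
  by rewrite -enormN opprB; exact: psum_lim_dist.
rewrite (le_trans (enormB _ x' _))// lerD//.
exact: psum_lim_dist.
Qed.

(** For [d > 0], [k] is the largest exponent with [d <= c ^+ k], and replacing [d] by [c ^+ k] loses
    at most a factor [c^(-1)]. For [d = 0] there is no largest one, and [eps] absorbs the error. *)
Lemma exists_scale (s d eps : R) : 0 < s -> 0 <= d <= 1 -> 0 < eps ->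
  exists k, d <= c ^+ k /\ (c `^ s) ^+ k <= c `^ (- s) * d `^ s + eps.
Proof.
have /andP[c0 c1] := c01; move=> s0 /andP[d0 d1] eps0.
have cs01 : 0 < c `^ s < 1.
  rewrite powR_gt0//=; have := @gt0_ltr_powR R s s0 c 1.
  by rewrite !nnegrE powR1 ler01 (ltW c0) => /(_ isT isT c1).
have [->|dn0] := eqVneq d 0.
  have [k /(_ k (leqnn _)) Hk] := expr_mul_lt_eps cs01 1 eps0.
  exists k; rewrite exprn_ge0 ?(ltW c0)// powR0 ?gt_eqF// mulr0 add0r.
  by rewrite mul1r in Hk; rewrite ltW.
have dp : 0 < d by rewrite lt_neqAle eq_sym dn0.
have ex : exists k, c ^+ k.+1 < d.
  have [k /(_ k.+1 (leqnSn _))] := expr_mul_lt_eps c01 1 dp.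
  by rewrite mul1r => Hk; exists k.
case: (ex_minnP ex) => k kd kmin; exists k; split.
  case: k kd kmin => [|k] kd kmin; first by rewrite expr0.
  by rewrite leNgt; apply/negP => /kmin; rewrite ltnn.
apply: (@le_trans _ _ (c `^ (- s) * d `^ s)); last by rewrite lerDl ltW.
have -> : (c `^ s) ^+ k = c `^ (- s) * (c ^+ k.+1) `^ s.
  rewrite -!powR_mulrn ?powR_ge0 ?(ltW c0)// -!powRrM -powRD ?(gt_eqF c0) ?implybT//.
  by congr (_ `^ _); rewrite -natr1; ring.
rewrite ler_wpM2l ?powR_ge0// ge0_ler_powR ?nnegrE ?exprn_ge0 ?(ltW s0) ?(ltW c0)//.
exact: ltW.
Qed.

Lemma lebesgue_cover_seq (T : eqType) (r : seq T) (P : T -> set R) (q : R) :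
  (forall v, exists I : set R, [/\ measurable I,
     (lebesgue_measure I <= q%:E)%E & P v `<=` I]) ->
  exists I : set R, [/\ measurable I,
     (lebesgue_measure I <= ((size r)%:R * q)%:E)%E &
     forall v, v \in r -> P v `<=` I].
Proof.
move=> H; elim: r => [|v r [I [mI Iq PI]]].
  by exists set0; split => //; rewrite measure0 mul0r.
have [I' [mI' Iq' PI']] := H v.
exists (I' `|` I); split; first exact: measurableU.
  rewrite (le_trans (measureU2 _ _ _))//= -natr1 mulrDl mul1r addrC EFinD.
  exact: leeD.
move=> u; rewrite inE => /orP[/eqP ->|ur] x Px; [left|right].
  exact: PI'.
exact: PI ur _ Px.
Qed.

(** [w x] is a digit sequence driven by the real [x]. By [Qw], its first [k] digits determine which
    of the [Q k] equal subintervals of [[0, 1[] contains [x]. *)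
Variables (D : set 'cV[int]_n) (w : R -> nat -> 'cV[int]_n) (Q : nat -> nat).
Variable K : R.
Hypothesis Dres : forall d d', D d -> D d' -> in_lattice A (d - d') -> d = d'.
Hypothesis Dw : forall x j, D (w x j).
Hypothesis DK : forall d, D d -> enorm (realv R d) <= K.
Hypothesis Q0 : forall k, (0 < Q k)%N.
Hypothesis Qw : forall k (x y : R), 0 <= x < 1 -> 0 <= y < 1 ->
  (forall j, (j < k)%N -> w x j = w y j) ->
  Num.truncn (x * (Q k)%:R) = Num.truncn (y * (Q k)%:R).

(** A lattice point of level [k] determines the first [k] digits, hence a single interval of length
    [1 / Q k]. *)
Lemma lattice_point_preimage_cover k (z : 'cV[int]_n) :
  exists I : set R, [/\ measurable I, (lebesgue_measure I <= ((Q k)%:R^-1)%:E)%E &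
    [set x | 0 <= x < 1 /\ lattice_point (w x) k = z] `<=` I].
Proof.
set P := [set x | _].
have [->|/set0P[x [x01 xz]]] := eqVneq P set0.
  by exists set0; split => //; rewrite measure0 lee_fin invr_ge0.
have Qp : 0 < (Q k)%:R :> R by rewrite ltr0n.
pose m := Num.truncn (x * (Q k)%:R).
exists `[m%:R / (Q k)%:R, m.+1%:R / (Q k)%:R[%classic; split.
- exact: measurable_itv.
- rewrite lebesgue_measure_itv /= lte_fin.
  case: ifP => _; last by rewrite lee_fin invr_ge0.
  by rewrite -EFinB -mulrBl -natr1 addrAC subrr add0r mul1r.
- move=> y [y01 yz]; rewrite /= in_itv /= ler_pdivrMr// ltr_pdivlMr//.
  have -> : m = Num.truncn (y * (Q k)%:R).
    apply: Qw => //; apply: lattice_point_inj Dres _ _ _ => //.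
    by rewrite xz yz.
  by apply: truncn_itv; rewrite mulr_ge0//; case/andP: y01.
Qed.

(** The lattice points of level [k] arising from [U] lie in a cube of half-side [L] around one of
    them, and [V] encodes the offsets shifted by [L]. Taking a measurable superset [I] avoids
    proving the preimage of [U] measurable. *)
Lemma bounded_preimage_cover : exists M : nat,
  forall k (U : set 'cV[R]_n),
  (forall x y, U x -> U y -> enorm (x - y) <= c ^+ k) ->
  exists I : set R, [/\ measurable I,
    (lebesgue_measure I <= (M%:R / (Q k)%:R)%:E)%E &
    forall (x : R) (p : 'cV[R]_n), 0 <= x < 1 -> psum B (fun j => realv R (w x j)) @ \oo --> p ->
      U p -> I x].
Proof.
pose L := (Num.truncn (1 + (K / (1 - c) + K / (1 - c)))).+1.
pose V := {ffun 'I_n -> 'I_(L + L).+1}.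
exists (size (enum V)) => k U Uk.
pose G := [set x | 0 <= x < 1 /\
  exists2 p, psum B (fun j => realv R (w x j)) @ \oo --> p & U p].
have [G0|/set0P[x0 [x001 [p0 xp0 Up0]]]] := eqVneq G set0.
  exists set0; split => //; first by rewrite measure0 lee_fin divr_ge0.
  move=> x p x01 xp Up.
  have Gx : G x by split=> //; exists p.
  by rewrite G0 in Gx.
pose z0 := lattice_point (w x0) k.
pose z (v : V) : 'cV[int]_n := z0 + \col_i ((v i)%:Z - L%:Z).
have [I [mI Iq zI]] := lebesgue_cover_seq (enum V)
  (fun v => lattice_point_preimage_cover k (z v)).
exists I; split => // x p x01 xp Up.
have wK y j : enorm (realv R (w y j)) <= K by exact: DK.
have := lattice_point_dist (wK x) (wK x0) xp xp0 (Uk _ _ Up Up0).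
rewrite -realvB -/z0; set u := lattice_point (w x) k - z0 => uL.
have uiL i : `|u i 0| <= L%:Z.
  have : `|(u i 0)%:~R| <= L%:R :> R.
    have := enorm_coord (realv R u) i; rewrite mxE => /le_trans; apply.
    exact: le_trans uL (ltW (truncnS_gt _)).
  by rewrite -intr_norm -[L%:R]/(L%:Z%:~R) ler_int.
pose v : V := [ffun i => inord (absz (u i 0 + L%:Z))].
apply: (zI v); first by rewrite mem_enum.
split=> //; rewrite /z.
suff -> : \col_i ((v i)%:Z - L%:Z) = u by rewrite /u addrC subrK.
apply/matrixP => i j; rewrite ord1 mxE ffunE inordK; last first.
  by have := uiL i; lia.
have shiftK (t : int) (l : nat) : `|t| <= l%:Z -> (absz (t + l%:Z))%:Z - l%:Z = t.
  by lia.
exact: shiftK (uiL i).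
Qed.

Lemma hausdorff_measure_neq0 (s C : R) (S : set 'cV[R]_n) :
  0 < s -> (forall k, (Q k)%:R^-1 <= C * (c `^ s) ^+ k) ->
  (forall (x : R) (p : 'cV[R]_n), 0 <= x < 1 ->
     psum B (fun j => realv R (w x j)) @ \oo --> p -> S p) ->
  hausdorff_measure s S <> 0%E.
Proof.
have /andP[c0 c1] := c01; move=> s0 QC wS S0.
have [M HM] := bounded_preimage_cover.
have C0 : 0 < C.
  have := QC 0%N; rewrite expr0 mulr1; apply: lt_le_trans.
  by rewrite invr_gt0 ltr0n.
(* [C'] gathers the number of lattice points, the constant of [Q] and the loss in [exists_scale].
   The cover is chosen with [C'] times its [s]-sum at most [1/4]; the error terms add up to [1/2],
   so the total stays below [1]. *)
pose C' := M.+1%:R * C * c `^ (- s).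
have C'0 : 0 < C' by rewrite !mulr_gt0// powR_gt0.
have eps0 : 0 < (4 * C')^-1 by rewrite invr_gt0 mulr_gt0.
have [U [SU Ud Ueps]] := hausdorff_measure_eq0_cover S0 ltr01 eps0.
have Udiam i : 0 <= diam (U i) <= 1.
  by rewrite (diam_ge0 (Ud i))//= diam_le//; exact: Ud.
have e0 i : 0 < 2^-1 / (2 ^ i.+1)%:R / (M.+1%:R * C) :> R.
  by rewrite !divr_gt0 ?mulr_gt0 ?ltr0n ?expn_gt0.
have /choice[I HI] : forall i, exists I : set R, [/\ measurable I,
    (lebesgue_measure I <=
       (C' * diam (U i) `^ s)%:E + (2^-1 / (2 ^ i.+1)%:R)%:E)%E &
    forall (x : R) (p : 'cV[R]_n), 0 <= x < 1 -> psum B (fun j => realv R (w x j)) @ \oo --> p ->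
      U i p -> I x].
  move=> i; have [k [dk ck]] := exists_scale s0 (Udiam i) (e0 i).
  have [x y Ux Uy|I [mI Iq UI]] := HM k (U i).
    by apply: le_trans dk; exact: le_diam (Ud i) Ux Uy.
  exists I; split => //; apply: (le_trans Iq).
  rewrite -EFinD lee_fin.
  apply: (@le_trans _ _ (M.+1%:R * C * (c `^ s) ^+ k)).
    rewrite -mulrA ler_pM ?invr_ge0// ler_nat//.
  apply: (@le_trans _ _ (M.+1%:R * C * (c `^ (- s) * diam (U i) `^ s +
      2^-1 / (2 ^ i.+1)%:R / (M.+1%:R * C)))).
    by rewrite ler_wpM2l// ltW// mulr_gt0.
  rewrite mulrDr mulrA -/C' lerD2l mulrC divfK//.
  by rewrite gt_eqF// mulr_gt0.
have : (lebesgue_measure (`[0%R, 1%R[%classic : set R) <=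
    \sum_(i <oo) lebesgue_measure (I i))%E.
  apply: measure_sigma_subadditive => //.
  - by move=> i; case: (HI i).
  - move=> x; rewrite /= in_itv /= => x01.
    have /cvg_ex[p xp] : cvg (psum B (fun j => realv R (w x j)) @ \oo).
      by apply: (psum_is_cvg c01 Bc (K := K)) => j; exact: DK.
    have [i _ Ui] := SU _ (wS x p x01 xp).
    by exists i => //; have [_ _ /(_ x p x01 xp Ui)] := HI i.
rewrite lebesgue_measure_itv /= lte_fin ltr01 sube0.
apply/negP; rewrite -ltNge.
apply: (@le_lt_trans _ _ (\sum_(i <oo)
    ((C' * diam (U i) `^ s)%:E + (2^-1 / (2 ^ i.+1)%:R)%:E))%E).
  by apply: lee_nneseries => [i _ _|i _]; [exact: measure_ge0|case: (HI i)].
apply: le_lt_trans (epsilon_trick _ _ _) _ => //.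
  by move=> i; rewrite lee_fin mulr_ge0 ?powR_ge0// ltW.
under eq_eseriesr do rewrite EFinM.
rewrite nneseriesZl; last by move=> i _; rewrite lee_fin powR_ge0.
have H : (C'%:E * \sum_(i <oo) (diam (U i) `^ s)%:E <= (4^-1)%:E)%E.
  apply: (@le_trans _ _ (C'%:E * ((4 * C')^-1)%:E)%E).
    by rewrite lee_pmul2l ?lte_fin// ltW.
  by rewrite -EFinM lee_fin invfM mulrCA divff ?mulr1// gt_eqF.
apply: le_lt_trans (leeD H (lexx _)) _.
by rewrite -EFinD lte_fin; lra.
Qed.

End LowerBound.

(** * Finiteness of the digit set and an extremal difference *)

(** As [A *m \adj A] is the scalar [\det A], vectors congruent coordinatewise mod [\det A] are
    congruent mod [A]; so [D] injects into a finite set of remainders. *)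
Lemma residue_system_finite n (A : 'M[int]_n) (D : set 'cV[int]_n) :
  \det A != 0 ->
  (forall d d', D d -> D d' -> in_lattice A (d - d') -> d = d') ->
  exists2 s : seq 'cV[int]_n, uniq s & D = [set` s].
Proof.
move=> detA Dres.
suff /finite_seqP[s ->] : finite_set D.
  exists (undup s); first exact: undup_uniq.
  by apply/seteqP; split => x /=; rewrite mem_undup.
pose N := absz (\det A).
pose f (d : 'cV[int]_n) : {ffun 'I_n -> 'I_N.+1} :=
  [ffun i => inord (absz ((d i 0)%R %% \det A)%Z)].
have f_inj d d' : D d -> D d' -> f d = f d' -> d = d'.
  move=> Dd Dd' fdd'; apply: Dres => //.
  have H i : (\det A %| (d i 0 - d' i 0)%R)%Z.
    have modN (z : int) : (absz (z %% \det A)%Z < N.+1)%N.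
      by have := ltz_mod z detA; have := modz_ge0 z detA; rewrite /N; lia.
    move/ffunP/(_ i)/(congr1 val) : fdd'; rewrite !ffunE /= !inordK//.
    move=> E; rewrite -eqz_mod_dvd; apply/eqP.
    by rewrite -(gez0_abs (modz_ge0 (d i 0) detA)) E gez0_abs// modz_ge0.
  exists (\adj A *m \col_i ((d i 0 - d' i 0)%R %/ \det A)%Z).
  rewrite mulmxA mul_mx_adj mul_scalar_mx; apply/matrixP => i j.
  by rewrite ord1 !mxE mulrC divzK.
pose g v : 'cV[int]_n := xget 0 [set d | D d /\ f d = v].
have gf d : D d -> g (f d) = d.
  move=> Dd; have [Dg fg] : [set d' | D d' /\ f d' = f d] (g (f d)).
    by apply: (xgetPex 0 (P := [set d' | D d' /\ f d' = f d])); exists d.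
  exact: f_inj.
apply: (sub_finite_set (B := g @` setT)).
  by move=> d Dd; exists (f d) => //; exact: gf.
apply: finite_image; exact: finite_finset.
Qed.

(* The pair at maximal distance: were [e - e' = d1 - d0] with [u := e - d1 != 0],
   one of the diagonals [e - d0], [d1 - e'] would be longer, by the
   parallelogram law. *)
Lemma exists_unique_difference n (s : seq 'cV[int]_n) : s != [::] ->
  exists d1 d0, [/\ d1 \in s, d0 \in s &
    forall e e', e \in s -> e' \in s -> e - e' = d1 - d0 -> e = d1].
Proof.
case: s => // x0 s' _; set s := x0 :: s'.
pose sq (z : 'cV[int]_n) : int := \sum_i z i 0 ^+ 2.
have x0s : x0 \in s by rewrite inE eqxx.
pose p0 : seq_sub s * seq_sub s := (SeqSub x0s, SeqSub x0s).
have [[[d1 d1s] [d0 d0s]] _ /= maxd] :=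
  @arg_maxP _ _ _ p0 xpredT (fun p => sq (ssval p.1 - ssval p.2)) isT.
exists d1, d0; split => // e e' es e's ee'.
set u := e - d1.
have H1 : sq (d1 - e') <= sq (d1 - d0) := maxd (SeqSub d1s, SeqSub e's) isT.
have H2 : sq (e - d0) <= sq (d1 - d0) := maxd (SeqSub es, SeqSub d0s) isT.
have e'E : e' = d0 + u by rewrite -[LHS](subKr e) ee' opprB addrCA.
have eE : e = d1 + u by rewrite addrC subrK.
have H : sq (d1 - e') + sq (e - d0) = 2 * sq (d1 - d0) + 2 * sq u.
  rewrite /sq !mulr_sumr -!big_split /=; apply: eq_bigr => i _.
  by rewrite e'E eE !mxE; ring.
have sqge0 i : true -> 0 <= u i 0 ^+ 2 by move=> _; exact: sqr_ge0.
have u0 : sq u = 0.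
  have : 0 <= sq u by exact: sumr_ge0.
  by move: H H1 H2; lia.
have {}u0 : u = 0.
  apply/matrixP => i j; rewrite ord1 [RHS]mxE; apply/eqP.
  by rewrite -sqrf_eq0 (psumr_eq0P sqge0 u0).
by apply/eqP; rewrite -subr_eq0 -/u u0.
Qed.

(** * Expansions in base [q] *)

Lemma truncn_mul_divn (R : realType) (x : R) q : 0 <= x -> (0 < q)%N ->
  (Num.truncn (x * q%:R) %/ q)%N = Num.truncn x.
Proof.
move=> x0 q0; apply/esym/eqP; rewrite truncn_eq//.
have qp : 0 < q%:R :> R by rewrite ltr0n.
have xq0 : 0 <= x * q%:R by rewrite mulr_ge0.
have /andP[H1 H2] := truncn_itv xq0.
set N := Num.truncn _ in H1 H2 *; apply/andP; split.
  rewrite -(ler_pM2r qp) -natrM; apply: le_trans H1.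
  by rewrite ler_nat leq_trunc_div.
rewrite -(ltr_pM2r qp) -natrM; apply: (lt_le_trans H2).
by rewrite ler_nat ltn_ceil.
Qed.

Definition radix_digit (R : realType) q (x : R) i : nat :=
  (Num.truncn (x * (q ^ i.+1)%:R) %% q)%N.

(** By induction, the first [i] digits of [x] in [[0, 1[] determine its interval of length [q^(-i)],
    as [Qw] requires. *)
Lemma truncn_radixS (R : realType) q (x : R) i : 0 <= x -> (0 < q)%N ->
  Num.truncn (x * (q ^ i.+1)%:R) =
  (Num.truncn (x * (q ^ i)%:R) * q + radix_digit q x i)%N.
Proof.
move=> x0 q0.
rewrite -(truncn_mul_divn (mulr_ge0 x0 (ler0n _ (q ^ i))) q0).
by rewrite -mulrA -natrM -expnSr [LHS](divn_eq _ q).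
Qed.

(** * Ranks of frequency [t], from a Beatty sequence *)

Section Slots.
Variables (R : realType) (t : R) (m : nat).
Hypothesis t01 : 0 <= t <= 1.

Definition beatty (k : nat) : nat := Num.truncn (k%:R * t).

(** As [t <= 1], the Beatty sequence increases by [0] or [1], so its jumps are counted by [beatty].
    Ranks below [m] are excluded because the digits there are prescribed. *)
Definition slot j : bool := (m <= j)%N && (beatty j.+1 != beatty j).

Definition slot_count k : nat := (\sum_(j < k) slot j)%N.

Lemma beattyS k : (beatty k <= beatty k.+1 <= (beatty k).+1)%N.
Proof.
have /andP[t0 t1] := t01.
have kt0 : 0 <= k%:R * t by rewrite mulr_ge0.
apply/andP; split.
  by apply: le_truncn; rewrite ler_wpM2r// ler_nat.
rewrite -ltnS truncn_lt_nat ?mulr_ge0//.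
rewrite -natr1 mulrDl mul1r -[X in _ < X]natr1 ltr_leD//.
exact: truncnS_gt.
Qed.

Lemma slot_countS k : slot_count k.+1 = (slot_count k + slot k)%N.
Proof. by rewrite /slot_count big_ord_recr. Qed.

Lemma slot_count_le_beatty k : (slot_count k <= beatty k)%N.
Proof.
elim: k => [|k IH]; first by rewrite /slot_count big_ord0.
have := beattyS k; rewrite slot_countS /slot.
by case: (leqP m k); case: (eqVneq (beatty k.+1) (beatty k)) => /=; lia.
Qed.

Lemma beatty_le_slot_count k : (beatty k <= slot_count k + m)%N.
Proof.
(* The inductive form: at most one jump is lost for each rank below [m]. *)
suff : (beatty k <= slot_count k + minn k m)%N by lia.
elim: k => [|k IH]; first by rewrite /beatty mul0r truncn0.
have := beattyS k; rewrite slot_countS /slot.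
by case: (leqP m k); case: (eqVneq (beatty k.+1) (beatty k)) => /=; lia.
Qed.

End Slots.

(** Take logarithms: the upper bound on [l] says exactly that [t <= 1]. When [q = 1] one cannot
    divide by [ln q], but then [l = 0]. *)
Lemma powR_exponent (R : realType) (c q l : R) :
  0 < c < 1 -> 1 <= q -> 0 <= l <= ln q / - ln c ->
  exists2 t, 0 <= t <= 1 & q `^ t = c `^ (- l).
Proof.
move=> /andP[c0 c1] q1 /andP[l0 lq].
have q0 : 0 < q := lt_le_trans ltr01 q1.
have lc : 0 < - ln c by rewrite oppr_gt0 ln_lt0// c0 c1.
have powE a x : 0 < a -> a `^ x = expR (x * ln a) :> R.
  by move=> a0; rewrite /powR gt_eqF.
have [q11|q_neq1] := eqVneq q 1.
  exists 0; first by rewrite lexx ler01.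
  have -> : l = 0.
    by apply/eqP; rewrite eq_le l0 andbT; rewrite q11 ln1 mul0r in lq.
  by rewrite oppr0 !powRr0.
have lnq : 0 < ln q by rewrite ln_gt0// lt_neqAle eq_sym q_neq1.
exists (l * - ln c / ln q).
  rewrite divr_ge0 ?mulr_ge0 ?(ltW lc) ?(ltW lnq)//=.
  by rewrite ler_pdivrMr// mul1r -ler_pdivlMr.
rewrite !powE// divfK ?gt_eqF//; congr expR; ring.
Qed.

(** * Intersections of [T] with its translates *)

Section DigitSets.
Variables (R : realType) (n : nat) (A : 'M[int]_n) (D : set 'cV[int]_n).
Variables (s : seq 'cV[int]_n) (c : R).
Let B : 'M[R]_n := invmx (realm R A).
Let T : set 'cV[R]_n := T_set A (real_digits R D).
Hypothesis c01 : 0 < c < 1.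
Hypothesis Bc : forall x : 'cV[R]_n, enorm (B *m x) = c * enorm x.
Hypothesis BA : B *m realm R A = 1%:M.
Hypothesis s_uniq : uniq s.
Hypothesis DE : D = [set` s].
Hypothesis Dres : forall d d', D d -> D d' -> in_lattice A (d - d') -> d = d'.
Hypothesis Duniq : unique_reps A (diff_set (real_digits R D)).

Lemma psum_realvB (f g : nat -> 'cV[int]_n) :
  psum B (fun j => realv R (f j - g j)) =
  psum B (fun j => realv R (f j)) - psum B (fun j => realv R (g j)).
Proof.
apply/funext => N; rewrite fctE /psum.
rewrite -sumrB; apply: eq_bigr => j _.
by rewrite realvB mulmxBr.
Qed.

Lemma T_setP (x : 'cV[R]_n) : T x <->
  exists2 f, forall j, D (f j) & psum B (fun j => realv R (f j)) @ \oo --> x.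
Proof.
split=> [[e [eD ex]]|[f fD fx]].
  have /choice[f Hf] : forall j, exists d, D d /\ realv R d = e j.
    by move=> j; have [d Dd de] := eD j; exists d.
  exists f; first by move=> j; case: (Hf j).
  suff -> : (fun j => realv R (f j)) = e by [].
  by apply/funext => j; case: (Hf j).
by exists (fun j => realv R (f j)); split => // j; exists (f j).
Qed.

(** If [x = y + alpha] with [x] and [y] in [T], subtracting their expansions yields a representation
    of [alpha], which uniqueness identifies with [f - g]. *)
Lemma T_cap_translateP (f g : nat -> 'cV[int]_n) (alpha x : 'cV[R]_n) :
  (forall j, D (f j)) -> (forall j, D (g j)) ->
  psum B (fun j => realv R (f j - g j)) @ \oo --> alpha ->
  (T `&` translate T alpha) x <->
  exists2 e, (forall j, D (e j) /\ D (e j - (f j - g j))) &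
    psum B (fun j => realv R (e j)) @ \oo --> x.
Proof.
move=> Df Dg fg.
have diffD d d' : D d -> D d' -> diff_set (real_digits R D) (realv R (d - d')).
  move=> Dd Dd'; rewrite realvB; exists (realv R d); first by exists d.
  by exists (realv R d') => //; exists d'.
split=> [[/T_setP[e De ex] [y /T_setP[e' De' e'y] yx]]|[e De ex]].
  have ee' : psum B (fun j => realv R (e j - e' j)) @ \oo --> alpha.
    have -> : alpha = x - y by rewrite -yx addrAC subrr add0r.
    by rewrite psum_realvB; exact: cvgB.
  have fgrep : is_rep A (diff_set (real_digits R D))
      (fun j => realv R (f j - g j)) alpha.
    by split => // j; exact: diffD.
  have eerep : is_rep A (diff_set (real_digits R D))
      (fun j => realv R (e j - e' j)) alpha.
    by split => // j; exact: diffD.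
  have Talpha : T_set A (diff_set (real_digits R D)) alpha.
    by exists (fun j => realv R (f j - g j)).
  have E := Duniq Talpha fgrep eerep.
  exists e => // j; split => //.
  by have /realv_inj -> := congr1 (fun h => h j) E; rewrite subKr.
split; first by apply/T_setP; exists e => // j; case: (De j).
exists (x - alpha); last by rewrite subrK.
apply/T_setP; exists (fun j => e j - (f j - g j)); first by move=> j; case: (De j).
by rewrite psum_realvB; exact: cvgB.
Qed.

Lemma digits_bounded : exists2 K : R, 0 <= K &
  forall d, D d -> enorm (realv R d) <= K.
Proof.
exists (\sum_(d <- s) enorm (realv R d)).
  by apply: sumr_ge0 => d _; exact: enorm_ge0.
rewrite DE => d /= ds; rewrite (big_rem d)//= lerDl.
by apply: sumr_ge0 => d' _; exact: enorm_ge0.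
Qed.

(** The right-hand side is the similarity dimension, at which [q = c^(-l)]. This bound is what makes
    the frequency [t] of [powR_exponent] available for every [lambda] up to the dimension of [T]. *)
Lemma hausdorff_dim_T_le : s != [::] ->
  hausdorff_dim T <= ln (size s)%:R / - ln c.
Proof.
move=> s0; have [K K0 DK] := digits_bounded.
have /andP[c0 c1] := c01.
have q1 : 1 <= (size s)%:R :> R by rewrite ler1n lt0n size_eq0.
have lc : 0 < - ln c by rewrite oppr_gt0 ln_lt0// c0 c1.
have l0 : 0 <= ln (size s)%:R / - ln c.
  by rewrite divr_ge0 ?ln_ge0// ltW.
apply: hausdorff_dim_le => // r lr.
apply: (hausdorff_measure_digits_eq0 c01 Bc (J := fun=> [seq realv R d | d <- s])
  (K := K) (C := 1) (l := ln (size s)%:R / - ln c)) => //.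
- by move=> _ _ /mapP[d ds ->]; apply: DK; rewrite DE.
- by rewrite l0 lr.
- move=> k; rewrite mul1r big_const_ord iter_muln_1 size_map natrX.
  have -> : c `^ (- (ln (size s)%:R / - ln c)) = (size s)%:R.
    rewrite /powR gt_eqF//.
    have -> : - (ln (size s)%:R / - ln c) * ln c = ln (size s)%:R.
      by field; rewrite -oppr_eq0 gt_eqF.
    by rewrite lnK// posrE (lt_le_trans ltr01).
  exact: lexx.
- move=> x /T_setP[f Df fx]; exists (fun j => realv R (f j)) => // j.
  by apply: map_f; have := Df j; rewrite DE.
Qed.

(* Digits [f - g] up to rank [m], then [0] on the slots and [d1 - d0], which is
   a difference of digits in a single way, elsewhere. *)
Lemma level_translation (f g : nat -> 'cV[int]_n) (m : nat) (lambda : R) :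
  (forall j, D (f j)) -> (forall j, D (g j)) ->
  0 <= lambda <= hausdorff_dim T ->
  exists f' g' (alpha : 'cV[R]_n),
  [/\ forall j, D (f' j) /\ D (g' j),
      forall j, (j < m)%N -> f' j = f j /\ g' j = g j,
      psum B (fun j => realv R (f' j - g' j)) @ \oo --> alpha &
      hausdorff_dim (T `&` translate T alpha) = lambda].
Proof.
move=> Df Dg /andP[lambda0 lambdaT].
have [K K0 DK] := digits_bounded.
have /andP[c0 c1] := c01.
have s0 : s != [::].
  by have := Df 0%N; rewrite DE /=; case: (s).
pose q := size s.
have q0 : (0 < q)%N by rewrite lt0n size_eq0.
have q1 : 1 <= q%:R :> R by rewrite ler1n.
have [t t01 qt] : exists2 t, 0 <= t <= 1 & q%:R `^ t = c `^ (- lambda).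
  apply: powR_exponent => //; rewrite lambda0.
  exact: le_trans lambdaT (hausdorff_dim_T_le s0).
have /andP[t0 t1] := t01.
have [d1 [d0 [d1s d0s d1d0]]] := exists_unique_difference s0.
have [Dd1 Dd0] : D d1 /\ D d0 by rewrite DE.
have Ds d : D d -> d \in s by rewrite DE.
pose sl := slot t m; pose cnt := slot_count t m.
pose f' j := if (j < m)%N then f j else d1.
pose g' j := if (j < m)%N then g j else if sl j then d1 else d0.
have Df' j : D (f' j) by rewrite /f'; case: ifP.
have Dg' j : D (g' j) by rewrite /g'; do 2?case: ifP.
have /cvg_ex[alpha alphaE] :
    cvg (psum B (fun j => realv R (f' j - g' j)) @ \oo).
  apply: (psum_is_cvg c01 Bc (K := K + K)) => j.
  rewrite realvB (le_trans (enormD _ _))// lerD ?enormN//; exact: DK.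
exists f', g', alpha; split => //.
  by move=> j jm; rewrite /f' /g' jm.
have capP x := T_cap_translateP x Df' Dg' alphaE.
(* Since [q^t = c^(-lambda)], taking the integer part of [k t] changes [c^(-lambda k)] by a factor
   at most [q]. *)
have qt_beatty k : (q ^ beatty t k)%:R <= (c `^ (- lambda)) ^+ k.
  rewrite -qt -powR_mulrn ?powR_ge0// -powRrM natrX -powR_mulrn//.
  rewrite ler_powR// mulrC; have := truncn_itv (mulr_ge0 (ler0n R k) t0).
  by case/andP.
have beatty_qt k : (c `^ (- lambda)) ^+ k <= (q ^ (beatty t k).+1)%:R.
  rewrite -qt -powR_mulrn ?powR_ge0// -powRrM natrX -powR_mulrn//.
  by rewrite ler_powR// mulrC ltW// truncnS_gt.
have Hup r : lambda < r -> hausdorff_measure r (T `&` translate T alpha) = 0%E.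
  (* Allowing every digit below rank [m] costs only the constant factor [q ^ m]. *)
  move=> lr; pose J j : seq 'cV[R]_n :=
    if (j < m)%N || sl j then [seq realv R d | d <- s] else [:: realv R d1].
  apply: (hausdorff_measure_digits_eq0 c01 Bc (J := J) (K := K)
    (C := (q ^ m)%:R) (l := lambda)) => //.
  - move=> j d; rewrite /J; case: ifP => _; last by rewrite inE => /eqP ->; exact: DK.
    by move=> /mapP[d' d's ->]; apply: DK; rewrite DE.
  - by rewrite lambda0 lr.
  - move=> k; apply: (@le_trans _ _ (q ^ m * q ^ cnt k)%:R); last first.
      rewrite natrM ler_wpM2l//; apply: le_trans (qt_beatty k).
      by rewrite ler_nat leq_pexp2l// slot_count_le_beatty.
    rewrite ler_nat; apply: (@leq_trans (q ^ minn k m * q ^ cnt k)); last first.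
      by rewrite leq_mul2r leq_pexp2l ?geq_minr ?orbT.
    elim: k => [|k IH]; first by rewrite big_ord0 muln_gt0 !expn_gt0 q0.
    rewrite big_ord_recr /= /cnt slot_countS -/(cnt k) -/(sl k).
    have Jk : (size (J k) <= q ^ ((k < m) + sl k))%N.
      rewrite /J; case: (k < m)%N; case: (sl k) => /=; rewrite ?size_map//.
      + by rewrite -/q (leq_pexp2l q0 (_ : 1 <= 2)%N).
    apply: (leq_trans (leq_mul IH Jk)); rewrite -!expnD leq_pexp2l//.
    have : (minn k m + (k < m) <= minn k.+1 m)%N by clear; lia.
    by move: (cnt k) (nat_of_bool (sl k)) => a b; clear; lia.
  - move=> x /capP[e De ex]; exists (fun j => realv R (e j)) => // j.
    have [] := De j; rewrite /J /f' /g'.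
    case: ifP => /= [_|jm].
      by move=> Dej _; apply/map_f/Ds.
    case: ifP => [_|_] Dej.
      by move=> _; apply/map_f/Ds.
    (* Off the slots, [e j] and [e j - (d1 - d0)] are both digits, which forces [e j = d1]. *)
    move=> Dej'; rewrite inE; apply/eqP; congr realv.
    by apply: (d1d0 _ (e j - (d1 - d0))); [exact: Ds|exact: Ds|rewrite subKr].
apply/eqP; rewrite eq_le; apply/andP; split; first exact: hausdorff_dim_le.
apply: (le_hausdorff_dim lambda0 Hup) => r r0 rl.
(* The successive base-[q] digits of [x] are spent on the successive slots, [cnt j] being the number
   of slots before [j]; elsewhere the digit is fixed. *)
pose w (x : R) j := if sl j then nth 0 s (radix_digit q x (cnt j)) else f' j.
have Dw x j : D (w x j).
  by rewrite /w; case: ifP => // _; rewrite DE /= mem_nth// ltn_mod.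
apply: (hausdorff_measure_neq0 c01 Bc BA (D := D) (w := w)
  (Q := fun k => (q ^ cnt k)%N) (K := K) Dres Dw DK _ _ (C := (q ^ m.+1)%:R)) => //.
- by move=> k; rewrite expn_gt0 q0.
- move=> k x y x01 y01; have /andP[x0 x1] := x01; have /andP[y0 y1] := y01.
  elim: k => [|k IH] xy.
    rewrite /cnt /slot_count big_ord0 expn0 !mulr1.
    have trunc0 (z : R) : z < 1 -> Num.truncn z = 0%N.
      by move=> z1; apply/truncn0Pn; rewrite -ltNge.
    by rewrite !trunc0.
  have {}IH := IH (fun j jk => xy j (ltnW jk)).
  have := xy k (ltnSn k); rewrite /cnt slot_countS -/(cnt k) -/(sl k) /w.
  case: ifP => _; last by rewrite addn0.
  (* As [s] has no repetition, equal digit vectors come from equal radix digits. *)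
  move=> /eqP; rewrite nth_uniq ?ltn_mod// => /eqP xyk.
  by rewrite addn1 !truncn_radixS// IH xyk.
- move=> k.
  have qp j : 0 < (q ^ j)%:R :> R by rewrite ltr0n expn_gt0 q0.
  have cl_gt0 : 0 < c `^ (- lambda) by rewrite powR_gt0.
  (* The exponent [m.+1] accounts for the at most [m] jumps excluded below rank [m] and for the
     integer part of [k t]. *)
  apply: (@le_trans _ _ ((q ^ m.+1)%:R * (c `^ lambda) ^+ k)); last first.
    rewrite ler_wpM2l// lerXn2r ?nnegrE ?powR_ge0//.
    by rewrite ger_powR ?(ltW rl)// c0 ltW.
  rewrite -[c `^ lambda]invrK -powRN exprVn.
  rewrite ler_pdivlMr ?exprn_gt0// mulrC ler_pdivrMr// -natrM -expnD.
  apply: (le_trans (beatty_qt k)); rewrite ler_nat leq_pexp2l//.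
  have := beatty_le_slot_count m t01 k.
  by rewrite -/(cnt k); move: (cnt k) (beatty t k) => a b; clear; lia.
- move=> x p x01 xp; apply/capP; exists (w x) => // j; split; first exact: Dw.
  rewrite /f' /g'; have [jm|mj] := ltnP j m.
    by rewrite /w /sl /slot leqNgt jm /= /f' jm subKr.
  case slj : (sl j); first by rewrite subrr subr0.
  by rewrite /w slj /f' ltnNge mj /= subKr.
Qed.

End DigitSets.

(** * Density of the level sets *)

Theorem mainTheorem11 (R : realType) (n : nat) (A : 'M[int]_n)
  (Dfull D : set 'cV[int]_n) :
  \det A != 0 ->
  is_similarity (fun x : 'cV[R]_n => invmx (realm R A) *m x) ->
  complete_residue_system A Dfull ->
  self_affine_tile R A Dfull ->
  D `<=` Dfull ->
  unique_reps A (diff_set (real_digits R D)) ->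
  forall lambda : R, 0 <= lambda <= hausdorff_dim (T_set A (real_digits R D)) ->
    F_set A D `<=` closure ([set alpha | F_set A D alpha /\ Psi A D alpha = lambda]).
Proof.
move=> detA [c [c01 simc]] [Dfres _] _ DDf Duniq lambda lambdaT alpha.
set B := invmx (realm R A).
have Bc (x : 'cV[R]_n) : enorm (B *m x) = c * enorm x.
  by have := simc x 0; rewrite mulmx0 !subr0.
have BA : B *m realm R A = 1%:M.
  by rewrite mulVmx// unitmxE det_map_mx unitfE intr_eq0.
have Dres d d' : D d -> D d' -> in_lattice A (d - d') -> d = d'.
  by move=> /DDf Dd /DDf Dd'; exact: Dfres.
have [s s_uniq DE] := residue_system_finite detA Dres.
have [K K0 DK] := digits_bounded R DE.
move=> [x [/T_setP[f Df fx] [y /T_setP[g Dg gy] yx]]] V.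
rewrite -nbhs_ballE => -[eps /= eps0 Veps].
(* Differences of digits have norm at most [K + K]; the two summands bound the tails beyond rank [m]
   of the expansions of [alpha] and [beta], which share their first [m] digits. *)
have [m /(_ m (leqnn _)) Hm] :=
  expr_mul_lt_eps c01 ((K + K) / (1 - c) + (K + K) / (1 - c)) eps0.
have [f' [g' [beta [Dfg' fg'm fg'beta dimbeta]]]] :=
  level_translation c01 Bc BA s_uniq DE Dres Duniq m Df Dg lambdaT.
have Df' j : D (f' j) by case: (Dfg' j).
have Dg' j : D (g' j) by case: (Dfg' j).
exists beta; split.
  split => //.
  (* The point with digits [f'] witnesses that [T] meets its translate by [beta]. *)
  have /cvg_ex[x' fx'] : cvg (psum B (fun j => realv R (f' j)) @ \oo).
    by apply: (psum_is_cvg c01 Bc (K := K)) => j; exact: DK.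
  exists x'; apply/(T_cap_translateP Duniq x' Df' Dg' fg'beta).
  by exists f' => // j; rewrite subKr.
apply: Veps; rewrite -ball_normE /=.
have fg_alpha : psum B (fun j => realv R (f j - g j)) @ \oo --> alpha.
  have -> : alpha = x - y by rewrite -yx addrAC subrr add0r.
  by rewrite psum_realvB; exact: cvgB.
have diffK d d' : D d -> D d' -> enorm (realv R (d - d')) <= K + K.
  by move=> Dd Dd'; rewrite realvB (le_trans (enormD _ _))// lerD ?enormN//; exact: DK.
have head : psum B (fun j => realv R (f' j - g' j)) m =
    psum B (fun j => realv R (f j - g j)) m.
  by apply: eq_bigr => j _; have [-> ->] := fg'm j (ltn_ord j).
rewrite (le_lt_trans (norm_le_enorm _))// (le_lt_trans _ Hm)//.
rewrite (le_trans (enormB _ (psum B (fun j => realv R (f j - g j)) m) _))//.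
rewrite mulrDl lerD//.
  by apply: (psum_lim_dist c01 Bc (K := K + K)) => // j; exact: diffK.
rewrite -head -enormN opprB.
by apply: (psum_lim_dist c01 Bc (K := K + K)) => // j; exact: diffK.
Qed.
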